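(* Let $(\Omega,\mathcal{F},P)$ be a probability space and $d$ a positive integer. Let $G$ be a $\mathcal{T}_{\varepsilon,\lambda}$-closed $L^{0}$-convex subset of $L^{0}(\mathcal{F},\mathbb{R}^{d})$ and $T:G\rightarrow L^{0}(\mathcal{F},\mathbb{R}^{d})$ be a $\sigma$-stable $\mathcal{T}_{\varepsilon,\lambda}$-continuous mapping. Then $T$ is a.s. sequentially continuous.
   Context: $L^0(\mathcal{F},\mathbb{R}^d)$ is the set of a.s.-equivalence classes of random vectors $\Omega\to\mathbb{R}^d$, a module over $L^0(\mathcal{F})$ (classes of real random variables, with the a.s. order; $L^0_+(\mathcal{F})$ denotes the elements $\ge0$). The $L^0$-norm is $\|x\|=\sqrt{\sum_{i=1}^dx_i^2}$. $\mathcal{T}_{\varepsilon,\lambda}$ is the topology of convergence in probability. $\tilde I_A$ is the class of the indicator of $A\in\mathcal{F}$. $G$ is $L^0$-convex if $\lambda x+(1-\lambda)y\in G$ for $x,y\in G$, $\lambda\in L^0_+(\mathcal{F})$, $\lambda\le1$. $G$ is $\sigma$-stable if $\sum_n\tilde I_{A_n}x_n\in G$ for every sequence $\{x_n\}$ in $G$ and every countable measurable partition $\{A_n\}$ of $\Omega$ ($\mathcal{T}_{\varepsilon,\lambda}$-closed $L^0$-convex subsets are automatically $\sigma$-stable). $T$ is $\sigma$-stable if $T(\sum_n\tilde I_{A_n}x_n)=\sum_n\tilde I_{A_n}T(x_n)$ for all such sequences and partitions. $T$ is $\mathcal{T}_{\varepsilon,\lambda}$-continuous if it is continuous when domain and range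 carry $\mathcal{T}_{\varepsilon,\lambda}$. $T$ is a.s. sequentially continuous if for every $x\in G$ and every sequence $\{x_n\}$ in $G$ such that $\|x_n-x\|\to0$ a.s., one has $\|T(x_n)-T(x)\|\to0$ a.s. *)

(* Defs.v *)
From HB Require Import structures.
From mathcomp Require Import all_boot all_order all_algebra generic_quotient.
From mathcomp Require Import all_classical all_reals all_analysis.
From mathcomp Require Import measurable_realfun ring lra.

Set Implicit Arguments.
Unset Strict Implicit.
Unset Printing Implicit Defensive.

Import Order.TTheory GRing.Theory Num.Theory.
Import numFieldNormedType.Exports.
Local Open Scope classical_set_scope.
Local Open Scope ring_scope.

Ltac ae_app h := generalize h; apply: filter_app.

Section ae_class.
Context {dsp dsp' : measure_display} {Omega : measurableType dsp}
  {V : measurableType dsp'} {R : realType}.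
Variable P : probability Omega R.

Definition ae_class (f : Omega -> V) (mf : measurable_fun setT f) :
    {mfun_ P, Omega >-> V} :=
  (\pi_({mfun_ P, Omega >-> V}) (mfun_Sub (mem_set mf)))%qT.

Lemma ae_classE (f : Omega -> V) (mf : measurable_fun setT f) :
  {ae P, forall w, ae_class mf w = f w}.
Proof.
have : (\pi_({mfun_ P, Omega >-> V}) (repr (ae_class mf)) =
        \pi_({mfun_ P, Omega >-> V}) (mfun_Sub (mem_set mf)))%qT.
  by rewrite reprK.
move/eqmodP => /asboolP; apply: filterS => w /(_ I); exact.
Qed.

Lemma ae_class_eqP (x y : {mfun_ P, Omega >-> V}) :
  {ae P, forall w, x w = y w} <-> x = y.
Proof.
split=> [xy|->]; last exact: aeW.
rewrite -[x]reprK -[y]reprK; apply/eqmodP/asboolP.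
by apply: filterS xy => w xyw _; exact: xyw.
Qed.

Lemma ae_class_meas (x : {mfun_ P, Omega >-> V}) : measurable_fun setT x.
Proof. exact: measurable_funPT. Qed.

End ae_class.

Section L0_types.
Context {dsp : measure_display} {Omega : measurableType dsp} {R : realType}.

Definition L0 (P : probability Omega R) : Type := {mfun_ P, Omega >-> R}.

(* R^d is d.-tuple R with the product sigma-algebra, i.e. the Borel one. *)
Definition L0v (P : probability Omega R) (d : nat) : Type :=
  {mfun_ P, Omega >-> d.-tuple R}.

(* Evaluation goes through a chosen representative, so only almost everywhere
   statements about values are meaningful. *)
Definition L0_fun (P : probability Omega R) (x : L0 P) : Omega -> R :=
  aqEqMfun_to_fun x.

Definition L0v_fun (P : probability Omega R) d (x : L0v P d) :
  Omega -> d.-tuple R := aqEqMfun_to_fun x.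

Definition L0_class (P : probability Omega R) (f : Omega -> R)
  (mf : measurable_fun setT f) : L0 P := ae_class P mf.

Definition L0v_class (P : probability Omega R) d (f : Omega -> d.-tuple R)
  (mf : measurable_fun setT f) : L0v P d := ae_class P mf.

End L0_types.
Coercion L0_fun : L0 >-> Funclass.
Coercion L0v_fun : L0v >-> Funclass.

HB.instance Definition _ dsp (Omega : measurableType dsp) (R : realType)
  (P : probability Omega R) := Choice.on (L0 P).
HB.instance Definition _ dsp (Omega : measurableType dsp) (R : realType)
  (P : probability Omega R) d := Choice.on (L0v P d).

Section L0_basics.
Context {dsp : measure_display} {Omega : measurableType dsp} {R : realType}.
Variables (P : probability Omega R) (d : nat).

Lemma L0_classE (f : Omega -> R) (mf : measurable_fun setT f) :
  {ae P, forall w, L0_class P mf w = f w}.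
Proof. exact: ae_classE. Qed.

Lemma L0v_classE (f : Omega -> d.-tuple R) (mf : measurable_fun setT f) :
  {ae P, forall w, L0v_class P mf w = f w}.
Proof. exact: ae_classE. Qed.

Lemma L0_eqP (x y : L0 P) : {ae P, forall w, x w = y w} <-> x = y.
Proof. exact: ae_class_eqP. Qed.

Lemma L0v_eqP (x y : L0v P d) :
  {ae P, forall w i, tnth (x w) i = tnth (y w) i} <-> x = y.
Proof.
split=> [xy|->]; last exact: aeW.
by apply/ae_class_eqP; apply: filterS xy => w xyw; apply/eq_from_tnth/xyw.
Qed.

Lemma L0_meas (x : L0 P) : measurable_fun setT x.
Proof. exact: ae_class_meas. Qed.

Lemma L0v_meas (x : L0v P d) : measurable_fun setT x.
Proof. exact: ae_class_meas. Qed.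

Lemma L0v_tnth_meas (x : L0v P d) (i : 'I_d) :
  measurable_fun setT (fun w => tnth (x w) i).
Proof. by have /measurable_fun_tnthP := L0v_meas x; exact. Qed.

Lemma mktuple_meas (f : 'I_d -> Omega -> R) :
  (forall i, measurable_fun setT (f i)) ->
  measurable_fun setT (fun w => [tuple f i w | i < d]).
Proof.
move=> mf; apply/measurable_fun_tnthP => i.
by apply: eq_measurable_fun (mf i) => w _ /=; rewrite tnth_mktuple.
Qed.

Lemma L0v_mktupleE (f : 'I_d -> Omega -> R)
    (mf : forall i, measurable_fun setT (f i)) :
  {ae P, forall w i, tnth (L0v_class P (mktuple_meas mf) w) i = f i w}.
Proof.
have := L0v_classE (mktuple_meas mf).
by apply: filterS => w -> i; rewrite tnth_mktuple.
Qed.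

End L0_basics.

Section L0_ring.
Context {dsp : measure_display} {Omega : measurableType dsp} {R : realType}.
Variable P : probability Omega R.
Implicit Types x y z : L0 P.

Definition L0_cst (c : R) : L0 P := L0_class P (@measurable_cst _ _ _ _ setT c).
Definition L0_opp x : L0 P := L0_class P (measurable_funN (L0_meas x)).
Definition L0_add x y : L0 P := L0_class P (measurable_funD (L0_meas x) (L0_meas y)).
Definition L0_mul x y : L0 P := L0_class P (measurable_funM (L0_meas x) (L0_meas y)).

Lemma L0_cstE_ c : {ae P, forall w, L0_cst c w = c}.
Proof. exact: L0_classE. Qed.
Lemma L0_oppE_ x : {ae P, forall w, L0_opp x w = - x w}.
Proof. exact: L0_classE. Qed.
Lemma L0_addE_ x y : {ae P, forall w, L0_add x y w = x w + y w}.
Proof. exact: L0_classE. Qed.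
Lemma L0_mulE_ x y : {ae P, forall w, L0_mul x y w = x w * y w}.
Proof. exact: L0_classE. Qed.

Lemma L0_addA : associative L0_add.
Proof.
move=> x y z; apply/L0_eqP.
by ae_app (L0_addE_ x y); ae_app (L0_addE_ (L0_add x y) z);
  ae_app (L0_addE_ y z); ae_app (L0_addE_ x (L0_add y z)); apply: aeW => w -> -> -> ->; rewrite addrA.
Qed.

Lemma L0_addC : commutative L0_add.
Proof.
move=> x y; apply/L0_eqP.
by ae_app (L0_addE_ y x); ae_app (L0_addE_ x y); apply: aeW => w -> ->; rewrite addrC.
Qed.

Lemma L0_add0 : left_id (L0_cst 0) L0_add.
Proof.
move=> x; apply/L0_eqP.
by ae_app (L0_cstE_ 0); ae_app (L0_addE_ (L0_cst 0) x); apply: aeW => w -> ->; rewrite add0r.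
Qed.

Lemma L0_addN : left_inverse (L0_cst 0) L0_opp L0_add.
Proof.
move=> x; apply/L0_eqP.
by ae_app (L0_cstE_ 0); ae_app (L0_oppE_ x);
  ae_app (L0_addE_ (L0_opp x) x); apply: aeW => w -> -> ->;
  rewrite addNr.
Qed.

HB.instance Definition _ :=
  GRing.isZmodule.Build (L0 P) L0_addA L0_addC L0_add0 L0_addN.

Lemma L0_mulA : associative L0_mul.
Proof.
move=> x y z; apply/L0_eqP.
by ae_app (L0_mulE_ x y); ae_app (L0_mulE_ (L0_mul x y) z);
  ae_app (L0_mulE_ y z); ae_app (L0_mulE_ x (L0_mul y z)); apply: aeW => w -> -> -> ->; rewrite mulrA.
Qed.

Lemma L0_mulC : commutative L0_mul.
Proof.
move=> x y; apply/L0_eqP.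
by ae_app (L0_mulE_ y x); ae_app (L0_mulE_ x y); apply: aeW => w -> ->; rewrite mulrC.
Qed.

Lemma L0_mul1 : left_id (L0_cst 1) L0_mul.
Proof.
move=> x; apply/L0_eqP.
by ae_app (L0_cstE_ 1); ae_app (L0_mulE_ (L0_cst 1) x); apply: aeW => w -> ->; rewrite mul1r.
Qed.

Lemma L0_mulDl : left_distributive L0_mul L0_add.
Proof.
move=> x y z; apply/L0_eqP.
by ae_app (L0_mulE_ y z); ae_app (L0_mulE_ x z);
  ae_app (L0_addE_ (L0_mul x z) (L0_mul y z)); ae_app (L0_addE_ x y);
  ae_app (L0_mulE_ (L0_add x y) z); apply: aeW => w -> -> -> -> ->; rewrite mulrDl.
Qed.

HB.instance Definition _ :=
  GRing.Zmodule_isComPzRing.Build (L0 P) L0_mulA L0_mulC L0_mul1 L0_mulDl.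

End L0_ring.

Section L0v_module.
Context {dsp : measure_display} {Omega : measurableType dsp} {R : realType}.
Variables (P : probability Omega R) (d : nat).
Implicit Types (x y z : L0v P d) (a b : L0 P).

Definition L0v_zero : L0v P d :=
  L0v_class P (mktuple_meas (fun i : 'I_d => @measurable_cst _ _ _ _ setT (0 : R))).
Definition L0v_opp x : L0v P d :=
  L0v_class P (mktuple_meas (fun i =>
    measurable_funN (L0v_tnth_meas x i))).
Definition L0v_add x y : L0v P d :=
  L0v_class P (mktuple_meas (fun i =>
    measurable_funD (L0v_tnth_meas x i) (L0v_tnth_meas y i))).
Definition L0v_scale a x : L0v P d :=
  L0v_class P (mktuple_meas (fun i =>
    measurable_funM (L0_meas a) (L0v_tnth_meas x i))).

Lemma L0v_zeroE_ : {ae P, forall w i, tnth (L0v_zero w) i = 0}.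
Proof. exact: L0v_mktupleE. Qed.
Lemma L0v_oppE_ x : {ae P, forall w i, tnth (L0v_opp x w) i = - tnth (x w) i}.
Proof. exact: L0v_mktupleE. Qed.
Lemma L0v_addE_ x y :
  {ae P, forall w i, tnth (L0v_add x y w) i = tnth (x w) i + tnth (y w) i}.
Proof. exact: L0v_mktupleE. Qed.
Lemma L0v_scaleE_ a x :
  {ae P, forall w i, tnth (L0v_scale a x w) i = a w * tnth (x w) i}.
Proof. exact: L0v_mktupleE. Qed.

Lemma L0v_addA : associative L0v_add.
Proof.
move=> x y z; apply/L0v_eqP.
ae_app (L0v_addE_ x y); ae_app (L0v_addE_ (L0v_add x y) z);
  ae_app (L0v_addE_ y z); ae_app (L0v_addE_ x (L0v_add y z));
  apply: aeW => w e1 e2 e3 e4 i.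
by rewrite e1 e2 e3 e4 addrA.
Qed.

Lemma L0v_addC : commutative L0v_add.
Proof.
move=> x y; apply/L0v_eqP.
ae_app (L0v_addE_ y x); ae_app (L0v_addE_ x y); apply: aeW => w e1 e2 i.
by rewrite e1 e2 addrC.
Qed.

Lemma L0v_add0 : left_id L0v_zero L0v_add.
Proof.
move=> x; apply/L0v_eqP.
ae_app L0v_zeroE_; ae_app (L0v_addE_ L0v_zero x); apply: aeW => w e1 e2 i.
by rewrite e1 e2 add0r.
Qed.

Lemma L0v_addN : left_inverse L0v_zero L0v_opp L0v_add.
Proof.
move=> x; apply/L0v_eqP.
ae_app L0v_zeroE_; ae_app (L0v_oppE_ x);
  ae_app (L0v_addE_ (L0v_opp x) x); apply: aeW => w e1 e2 e3 i.
by rewrite e1 e2 e3 addNr.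
Qed.

HB.instance Definition _ :=
  GRing.isZmodule.Build (L0v P d) L0v_addA L0v_addC L0v_add0 L0v_addN.

Lemma L0v_scaleA a b x : L0v_scale a (L0v_scale b x) = L0v_scale (a * b) x.
Proof.
apply/L0v_eqP.
ae_app (L0_mulE_ a b); ae_app (L0v_scaleE_ (a * b) x);
  ae_app (L0v_scaleE_ b x); ae_app (L0v_scaleE_ a (L0v_scale b x));
  apply: aeW => w e1 e2 e3 e4 i.
by rewrite e1 e2 e3 e4 mulrA.
Qed.

Lemma L0v_scale1 : left_id 1 L0v_scale.
Proof.
move=> x; apply/L0v_eqP.
ae_app (L0_cstE_ P 1); ae_app (L0v_scaleE_ 1 x); apply: aeW => w e1 e2 i.
by rewrite e1 e2 mul1r.
Qed.

Lemma L0v_scaleDr : right_distributive L0v_scale +%R.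
Proof.
move=> a x y; apply/L0v_eqP.
ae_app (L0v_scaleE_ a y); ae_app (L0v_scaleE_ a x);
  ae_app (L0v_addE_ (L0v_scale a x) (L0v_scale a y));
  ae_app (L0v_addE_ x y); ae_app (L0v_scaleE_ a (x + y)); apply: aeW => w e1 e2 e3 e4 e5 i.
by rewrite e1 e2 e3 e4 e5 mulrDr.
Qed.

Lemma L0v_scaleDl x : {morph L0v_scale^~ x : a b / a + b}.
Proof.
move=> a b; apply/L0v_eqP.
ae_app (L0v_scaleE_ b x); ae_app (L0v_scaleE_ a x);
  ae_app (L0v_addE_ (L0v_scale a x) (L0v_scale b x));
  ae_app (L0_addE_ a b); ae_app (L0v_scaleE_ (a + b) x); apply: aeW => w e1 e2 e3 e4 e5 i.
by rewrite e1 e2 e3 e4 e5 mulrDl.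
Qed.

HB.instance Definition _ := GRing.Zmodule_isLmodule.Build (L0 P) (L0v P d)
  L0v_scaleA L0v_scale1 L0v_scaleDr L0v_scaleDl.

End L0v_module.

Section L0_evaluation.
Context {dsp : measure_display} {Omega : measurableType dsp} {R : realType}.
Variables (P : probability Omega R) (d : nat).
Implicit Types (x y : L0v P d) (a b : L0 P).

Lemma L0_0E : {ae P, forall w, (0 : L0 P) w = 0}.
Proof. exact: L0_cstE_. Qed.
Lemma L0_1E : {ae P, forall w, (1 : L0 P) w = 1}.
Proof. exact: L0_cstE_. Qed.
Lemma L0_NE a : {ae P, forall w, (- a : L0 P) w = - a w}.
Proof. exact: L0_oppE_. Qed.
Lemma L0_DE a b : {ae P, forall w, (a + b : L0 P) w = a w + b w}.
Proof. exact: L0_addE_. Qed.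
Lemma L0_ME a b : {ae P, forall w, (a * b : L0 P) w = a w * b w}.
Proof. exact: L0_mulE_. Qed.

Lemma L0v_0E : {ae P, forall w i, tnth ((0 : L0v P d) w) i = 0}.
Proof. exact: L0v_zeroE_. Qed.
Lemma L0v_NE x : {ae P, forall w i, tnth ((- x : L0v P d) w) i = - tnth (x w) i}.
Proof. exact: L0v_oppE_. Qed.
Lemma L0v_DE x y :
  {ae P, forall w i, tnth ((x + y : L0v P d) w) i = tnth (x w) i + tnth (y w) i}.
Proof. exact: L0v_addE_. Qed.
Lemma L0v_BE x y :
  {ae P, forall w i, tnth ((x - y : L0v P d) w) i = tnth (x w) i - tnth (y w) i}.
Proof.
have := L0v_NE y; have := L0v_DE x (- y).
by apply: filterS2 => w e1 e2 i; rewrite e1 e2.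
Qed.
Lemma L0v_ZE a x :
  {ae P, forall w i, tnth ((a *: x : L0v P d) w) i = a w * tnth (x w) i}.
Proof. exact: L0v_scaleE_. Qed.

End L0_evaluation.

Section L0_order_norm.
Context {dsp : measure_display} {Omega : measurableType dsp} {R : realType}.
Variable P : probability Omega R.

Definition L0_le (a b : L0 P) : Prop := {ae P, forall w, a w <= b w}.

Definition enorm d (v : d.-tuple R) : R := Num.sqrt (\sum_(i < d) tnth v i ^+ 2).

Lemma L0_norm_meas d (x : L0v P d) : measurable_fun setT (fun w => enorm (x w)).
Proof.
apply: (@measurableT_comp _ _ _ _ _ _ (@Num.sqrt R)).
  by apply: continuous_measurable_fun; exact: sqrt_continuous.
by apply: measurable_sum => i; apply: measurable_funX; exact: L0v_tnth_meas.
Qed.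

Definition L0_norm d (x : L0v P d) : L0 P := L0_class P (L0_norm_meas x).

Lemma L0_normE d (x : L0v P d) : {ae P, forall w, L0_norm x w = enorm (x w)}.
Proof. exact: L0_classE. Qed.

Definition L0_indic (A : set Omega) (mA : measurable A) : L0 P :=
  L0_class P (@measurable_indic _ _ R setT A mA).

End L0_order_norm.

Section L0_topology.
Context {dsp : measure_display} {Omega : measurableType dsp} {R : realType}.
Variables (P : probability Omega R) (d : nat).
Implicit Types (x y z : L0v P d) (e l : R).

(* y lies in x + N(e, l), where N(e, l) = {v | P(|v| < e) > 1 - l}. *)
Definition prob_close e l x y : Prop :=
  ((1 - l)%:E < P [set w | (L0_norm (x - y) w < e)%R])%E.

Definition L0v_entourage : set_system (L0v P d * L0v P d) :=
  [set E | exists e l, [/\ 0 < e, 0 < l < 1 &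
    [set xy | prob_close e l xy.1 xy.2] `<=` E]].

Lemma L0_norm_lt_meas x e : measurable [set w | L0_norm x w < e].
Proof.
have := L0_meas (L0_norm x) measurableT (measurable_itv `]-oo, e[).
by rewrite setTI; congr measurable; apply/seteqP; split=> w /=; rewrite in_itv.
Qed.

Lemma le_prob_ae (A B : set Omega) : measurable A -> measurable B ->
  {ae P, forall w, A w -> B w} -> (P A <= P B)%E.
Proof.
move=> mA mB [N [mN N0 sN]].
apply: (@le_trans _ _ (P (B `|` N))%E).
  apply: le_measure; rewrite ?inE//; first exact: measurableU.
  move=> w Aw; have [Bw|nBw] := pselect (B w); [by left|right].
  by apply: sN => /(_ Aw).
apply: le_trans (measureU2 _ _ _) _ => //.
by rewrite [X in (_ + X)%E]N0 adde0.
Qed.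

Lemma prob_setI_gt (A B : set Omega) (l1 l2 : R) :
  measurable A -> measurable B ->
  ((1 - l1)%:E < P A)%E -> ((1 - l2)%:E < P B)%E ->
  ((1 - (l1 + l2))%:E < P (A `&` B))%E.
Proof.
move=> mA mB.
have mC := measurableI _ _ mA mB.
have : (P (~` (A `&` B)) <= P (~` A) + P (~` B))%E.
  by rewrite setCI; apply: measureU2; exact: measurableC.
rewrite !probability_setC//.
rewrite -(fineK (fin_num_measure P _ mA)) -(fineK (fin_num_measure P _ mB)).
rewrite -(fineK (fin_num_measure P _ mC)) -!EFinB -EFinD lee_fin !lte_fin.
by lra.
Qed.

Lemma prob_closexx e l x : 0 < e -> 0 < l -> prob_close e l x x.
Proof.
move=> e0 l0; rewrite /prob_close subrr.
apply: (@lt_le_trans _ _ 1%E); first by rewrite lte_fin; lra.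
rewrite -(@probability_setT _ _ _ P); apply: le_prob_ae => //.
  exact: L0_norm_lt_meas.
ae_app (L0_normE (0 : L0v P d)); ae_app (L0v_0E P d).
apply: aeW => w e1 /= -> _; rewrite /enorm big1 ?sqrtr0// => i _.
by rewrite e1 expr0n.
Qed.

Lemma prob_close_sym e l x y : prob_close e l x y -> prob_close e l y x.
Proof.
move=> /lt_le_trans; apply; apply: le_prob_ae; do ?exact: L0_norm_lt_meas.
ae_app (L0_normE (x - y)); ae_app (L0_normE (y - x)).
ae_app (L0v_BE x y); ae_app (L0v_BE y x); apply: aeW => w /= e1 e2 -> ->.
rewrite /enorm; under eq_bigr do rewrite e2.
by under [X in _ -> Num.sqrt X < _]eq_bigr do rewrite e1 -opprB sqrrN.
Qed.

Lemma enorm_split (u v t : d.-tuple R) e : 0 < e ->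
  (forall i, tnth t i = tnth u i + tnth v i) ->
  enorm u < e / 2 -> enorm v < e / 2 -> enorm t < e.
Proof.
have sq (s : d.-tuple R) (c : R) : 0 < c ->
    (enorm s < c) = (\sum_(i < d) tnth s i ^+ 2 < c ^+ 2).
  move=> c0; rewrite /enorm -[X in _ < X](gtr0_norm c0) -sqrtr_sqr.
  by rewrite ltr_sqrt// exprn_gt0.
move=> e0 tE; rewrite !sq ?divr_gt0// => hu hv.
apply: (@le_lt_trans _ _ (2 * \sum_(i < d) tnth u i ^+ 2 +
                          2 * \sum_(i < d) tnth v i ^+ 2)); last by nra.
rewrite !mulr_sumr -big_split/=; apply: ler_sum => i _; rewrite tE.
have := sqr_ge0 (tnth u i - tnth v i); by nra.
Qed.

Lemma prob_close_split e l x y z : 0 < e ->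
  prob_close (e / 2) (l / 2) x y -> prob_close (e / 2) (l / 2) y z ->
  prob_close e l x z.
Proof.
move=> e0 xy yz.
have := prob_setI_gt (L0_norm_lt_meas _ _) (L0_norm_lt_meas _ _) xy yz.
rewrite -splitr => /lt_le_trans; apply; apply: le_prob_ae.
- by apply: measurableI; exact: L0_norm_lt_meas.
- exact: L0_norm_lt_meas.
ae_app (L0_normE (x - y)); ae_app (L0_normE (y - z)); ae_app (L0_normE (x - z)).
ae_app (L0v_BE x y); ae_app (L0v_BE y z); ae_app (L0v_BE x z).
apply: aeW => w e1 e2 e3 e4 e5 e6 [/=]; rewrite e4 e5 e6.
apply: enorm_split => // i; rewrite e1 e2 e3; by ring.
Qed.

Lemma L0v_entourage_filter : Filter L0v_entourage.
Proof.
split.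
- by exists 1, (1 / 2); split=> //; lra.
- move=> A B [e1 [l1 [e10 /andP[l10 l11] sA]]] [e2 [l2 [e20 /andP[l20 l21] sB]]].
  exists (Num.min e1 e2), (Num.min l1 l2); split.
  + by rewrite lt_min e10.
  + by rewrite lt_min l10 l20/= gt_min l11.
  move=> [x y] /= xy; split.
  + apply: sA => /=; apply: (@le_lt_trans _ _ (1 - Num.min l1 l2)%:E).
      by rewrite lee_fin lerB// ge_min lexx.
    apply: lt_le_trans xy _; apply: le_measure; rewrite ?inE;
      do ?exact: L0_norm_lt_meas.
    by move=> w /=; rewrite lt_min => /andP[].
  + apply: sB => /=; apply: (@le_lt_trans _ _ (1 - Num.min l1 l2)%:E).
      by rewrite lee_fin lerB// ge_min lexx orbT.
    apply: lt_le_trans xy _; apply: le_measure; rewrite ?inE;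
      do ?exact: L0_norm_lt_meas.
    by move=> w /=; rewrite lt_min => /andP[].
- move=> A B AB [e [l [e0 l0 sA]]]; exists e, l; split=> //.
  exact: subset_trans sA AB.
Qed.

Lemma L0v_entourage_diagonal A : L0v_entourage A -> diagonal `<=` A.
Proof.
move=> [e [l [e0 /andP[l0 _] sA]]] [x y] xy; apply: sA => /=.
have {xy} -> : x = y by [].
exact: prob_closexx.
Qed.

Lemma L0v_entourage_inv A : L0v_entourage A -> L0v_entourage (A^-1)%relation.
Proof.
move=> [e [l [e0 l0 sA]]]; exists e, l; split=> // -[x y] /= xy.
by apply: sA => /=; exact: prob_close_sym.
Qed.

Lemma L0v_entourage_split A : L0v_entourage A ->
  exists2 B, L0v_entourage B & (B \; B `<=` A)%relation.
Proof.
move=> [e [l [e0 l0 sA]]].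
exists [set xy | prob_close (e / 2) (l / 2) xy.1 xy.2].
  by exists (e / 2), (l / 2); split=> //; [rewrite divr_gt0|lra].
move=> [x z] [y /= xy yz]; apply: sA => /=.
exact: prob_close_split xy yz.
Qed.

HB.instance Definition _ := isUniform.Build (L0v P d)
  L0v_entourage_filter L0v_entourage_diagonal L0v_entourage_inv
  L0v_entourage_split.

End L0_topology.

(* Pieces may be empty, so finite partitions are included. *)
Record countable_partition dsp (Omega : measurableType dsp) := CountablePartition {
  piece :> nat -> set Omega;
  piece_meas : forall n, measurable (piece n);
  piece_triv : trivIset setT piece;
  piece_cover : \bigcup_n piece n = setT
}.

Section concatenation.
Context {dsp : measure_display} {Omega : measurableType dsp} {R : realType}.
Variables (P : probability Omega R) (d : nat).
Implicit Types (A : countable_partition Omega) (x : nat -> L0v P d).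

Lemma indic_series_cvg A (u : nat -> R) w n : A n w ->
  (fun N => \sum_(0 <= k < N) \1_(A k) w * u k) @ \oo --> u n.
Proof.
move=> Anw; apply: cvg_near_cst; near=> N.
have nN : (n < N)%N by near: N; exact: nbhs_infty_gt.
rewrite big_mkord (bigD1 (Ordinal nN))//= big1 ?addr0.
  by rewrite indicE mem_set// mul1r.
move=> k kn; rewrite indicE memNset ?mul0r// => Akw; move/eqP: kn; apply.
apply/val_inj => /=; apply: (@piece_triv _ _ A _ _ I I).
by exists w.
Unshelve. all: by end_near. Qed.

Lemma concat_meas A x (i : 'I_d) : measurable_fun setT
  (fun w => \big[+%R/0]_(0 <= n <oo) (\1_(A n) w * tnth (x n w) i)).
Proof.
apply: (@measurable_fun_cvg _ _ _ _
  (fun N w => \sum_(0 <= n < N) (\1_(A n) w * tnth (x n w) i))).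
  move=> N; apply: measurable_sum => n; apply: measurable_funM.
    exact/measurable_indic/piece_meas.
  exact: L0v_tnth_meas.
move=> w _; have : (\bigcup_n A n) w by rewrite piece_cover.
move=> [n _ Anw]; have c := @indic_series_cvg A (fun n => tnth (x n w) i) w n Anw.
by rewrite (cvg_lim _ c).
Qed.

(* The class of the pointwise sum of the 1_(A n) x_n. *)
Definition L0v_concat A x : L0v P d := L0v_class P (mktuple_meas (concat_meas A x)).

Lemma L0v_concatE A x : {ae P, forall w n, A n w -> L0v_concat A x w = x n w}.
Proof.
have := L0v_mktupleE P (concat_meas A x).
apply: filterS => w wE n Anw; apply: eq_from_tnth => i; rewrite wE.
exact: cvg_lim (@indic_series_cvg A (fun n => tnth (x n w) i) w n Anw).
Qed.

Lemma L0v_concat_indic A x n :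
  L0_indic P (piece_meas A n) *: L0v_concat A x =
  L0_indic P (piece_meas A n) *: x n.
Proof.
apply/L0v_eqP; ae_app (L0v_ZE (L0_indic P (piece_meas A n)) (x n)).
ae_app (L0v_ZE (L0_indic P (piece_meas A n)) (L0v_concat A x)).
ae_app (L0_classE P (@measurable_indic _ _ R setT _ (piece_meas A n))).
ae_app (L0v_concatE A x); apply: aeW => w e1 e2 e3 e4 i; rewrite e3 e4.
rewrite [L0_indic P _ w]e2 indicE; have [/set_mem Anw|] := boolP (w \in _).
  by rewrite (e1 n).
by rewrite !mul0r.
Qed.

End concatenation.

Section properties.
Context {dsp : measure_display} {Omega : measurableType dsp} {R : realType}.
Variables (P : probability Omega R) (d : nat).
Implicit Types (G : set (L0v P d)) (T : L0v P d -> L0v P d).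

Definition L0_convex G : Prop := forall (x y : L0v P d) (a : L0 P),
  G x -> G y -> L0_le 0 a -> L0_le a 1 -> G (a *: x + (1 - a) *: y).

(* Only the values of T on G matter: when G is closed and L0-convex it is
   sigma-stable, so the concatenation on the left-hand side lies in G. *)
Definition sigma_stable_on G T : Prop :=
  forall (A : countable_partition Omega) (x : nat -> L0v P d),
    (forall n, G (x n)) ->
    T (L0v_concat A x) = L0v_concat A (fun n => T (x n)).

Definition as_cvg (x : nat -> L0v P d) (y : L0v P d) : Prop :=
  {ae P, forall w, L0_norm (x n - y) w @[n --> \oo] --> 0}.

Definition as_seq_continuous_on G T : Prop :=
  forall (x : nat -> L0v P d) (y : L0v P d),
    (forall n, G (x n)) -> G y -> as_cvg x y -> as_cvg (fun n => T (x n)) (T y).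

End properties.

(* Main.v *)
Require Import Defs.
From HB Require Import structures.
From mathcomp Require Import all_boot all_order all_algebra.
From mathcomp Require Import all_classical all_reals all_analysis.
From mathcomp Require Import lra.
Import Order.TTheory GRing.Theory Num.Theory.
Import numFieldNormedType.Exports.
Local Open Scope classical_set_scope.
Local Open Scope ring_scope.

(* Gluing by sigma-stability, for any finite stretch u_m, ..., u_(m+k) of the
   sequence there is z in G which at each point w equals the u_j at which
   ||T u_j - T y||(w) is largest.  Hence ||z - y|| <= sup_(j >= m) ||u_j - y||
   and ||T z - T y|| = max_(m <= j <= m+k) ||T u_j - T y||.  If u_n -> y a.s.,
   the first bound makes z close to y in probability for large m, uniformly in
   k, so by continuity the maximum is small in probability, uniformly in k;
   letting k tend to infinity controls sup_(j >= m) ||T u_j - T y||, which is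
   a.s. convergence. *)

Section almost_sure_convergence.
Context {dsp : measure_display} {Omega : measurableType dsp} {R : realType}.
Context {P : probability Omega R} {d : nat}.
Implicit Types (u : nat -> L0v P d) (x y z : L0v P d) (e l : R).

(** The classes [x - z] and [y - z] have unrelated representatives, so agreement of [x] and [y] at a
    point passes to the norms only off a null set. *)
Lemma L0_norm_sub_local x y z :
  {ae P, forall w, x w = y w -> L0_norm (x - z) w = L0_norm (y - z) w}.
Proof.
ae_app (L0_normE (x - z)); ae_app (L0_normE (y - z)).
ae_app (L0v_BE x z); ae_app (L0v_BE y z).
apply: aeW => w ey ex -> -> xy; rewrite /enorm; congr Num.sqrt.
by apply: eq_bigr => i _; rewrite ex ey xy.
Qed.

Definition tail_close u y e (m : nat) : set Omega :=
  \bigcap_j [set w | L0_norm (u (m + j)%N - y) w < e].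

Lemma measurable_tail_close u y e m : measurable (tail_close u y e m).
Proof. by apply: bigcapT_measurable => j; exact: L0_norm_lt_meas. Qed.

Lemma measurable_bigcup_tail_close u y e :
  measurable (\bigcup_m tail_close u y e m).
Proof. by apply: bigcupT_measurable => m; exact: measurable_tail_close. Qed.

(** Continuity of [P] from below: the sets [tail_close u y e m] increase with [m], and a.s.
    convergence gives their union probability 1. *)
Lemma as_cvg_tail_close {u y e l} : as_cvg u y -> 0 < e -> 0 < l ->
  exists m, ((1 - l)%:E < P (tail_close u y e m))%E.
Proof.
move=> uy e0 l0.
have mB := measurable_bigcup_tail_close u y e.
have P1 : (1 <= P (\bigcup_m tail_close u y e m))%E.
  rewrite -(@probability_setT _ _ _ P); apply: le_prob_ae => //.
  apply: filterS uy => w /cvgr0Pnorm_lt /(_ e e0) [m _ mP] _.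
  exists m => // j _ /=; apply: le_lt_trans (ler_norm _) (mP _ _).
  exact: leq_addr.
have cv : (P \o tail_close u y e) k @[k --> \oo] -->
    P (\bigcup_m tail_close u y e m).
  apply: nondecreasing_cvg_mu => //; first by move=> m; exact: measurable_tail_close.
  move=> m n mn; apply/subsetPset => w mw j _.
  by rewrite -(subnKC mn) -addnA; exact: mw.
have : ((1 - l)%:E < P (\bigcup_m tail_close u y e m))%E.
  by apply: lt_le_trans P1; rewrite lte_fin; lra.
by move=> /open_ereal_gt' /cv [m _ mP]; exists m; exact: (mP m (leqnn m)).
Qed.

(** The hypothesis forces the union over [m] to have full measure for each [e]. Its inequality is
    non-strict so that it can be obtained as a limit of probabilities. *)
Lemma tail_close_as_cvg u y :
  (forall e l, 0 < e -> 0 < l < 1 ->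
    exists m, ((1 - l)%:E <= P (tail_close u y e m))%E) ->
  as_cvg u y.
Proof.
move=> tail.
have full e : 0 < e -> {ae P, forall w, (\bigcup_m tail_close u y e m) w}.
  move=> e0; have mB := measurable_bigcup_tail_close u y e.
  exists (~` \bigcup_m tail_close u y e m); split=> //; first exact: measurableC.
  suff -> : P (~` \bigcup_m tail_close u y e m) = 0%E by [].
  rewrite probability_setC//; apply/eqP; rewrite eq_le; apply/andP; split; last first.
    by rewrite sube_ge0 ?fin_num_measure// probability_le1.
  apply/lee_addgt0Pr => l l0; rewrite add0e.
  (* Here [l] is an arbitrary positive real, while [tail] requires a value below 1. *)
  have l'01 : 0 < Num.min l (1 / 2) < 1 by rewrite lt_min gt_min l0/=; lra.
  have [m tm] := tail e _ e0 l'01.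
  have : ((1 - Num.min l (1 / 2))%:E <= P (\bigcup_m tail_close u y e m))%E.
    apply: le_trans tm _; apply: le_measure; rewrite ?inE//.
      exact: measurable_tail_close.
    exact: bigcup_sup.
  rewrite -(fineK (fin_num_measure P _ mB)) -EFinB !lee_fin.
  have : Num.min l (1 / 2) <= l by rewrite ge_min lexx.
  by lra.
(* Countably many thresholds suffice and leave a single null set. *)
have : {ae P, forall w n, (\bigcup_m tail_close u y n.+1%:R^-1 m) w}.
  by apply: ae_foralln => n; apply: full; rewrite invr_gt0.
have : {ae P, forall w n, L0_norm (u n - y) w = enorm ((u n - y : L0v P d) w)}.
  by apply: ae_foralln => n; exact: L0_normE.
apply: filterS2 => w nE wt; apply/cvgr0Pnorm_lt => e e0.
have [n _ ne] := near_infty_natSinv_lt (PosNum e0).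
have [m _ mw] := wt n.
exists m => // k /= mk; have := mw (k - m)%N I; rewrite /= subnKC//.
move=> /lt_trans -/(_ _ (ne n (leqnn n))) /=.
by rewrite ger0_norm// nE sqrtr_ge0.
Qed.

End almost_sure_convergence.

Section stable_maps.
Context {dsp : measure_display} {Omega : measurableType dsp} {R : realType}.
Context {P : probability Omega R} {d : nat}.
Variables (G : set (L0v P d)) (T : L0v P d -> L0v P d).
Implicit Types (u : nat -> L0v P d) (x y z : L0v P d) (e l : R).

Lemma within_continuous_prob_close {y e l} : {within G, continuous T} -> G y ->
  0 < e -> 0 < l < 1 ->
  exists e' l', [/\ 0 < e', 0 < l' &
    forall z, G z -> prob_close e' l' y z -> prob_close e l (T y) (T z)].
Proof.
move=> /subspace_continuousP cT Gy e0 l01.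
have W : entourage [set xy : L0v P d * L0v P d | prob_close e l xy.1 xy.2].
  by exists e, l; split.
have nT : nbhs y [set z | G z -> prob_close e l (T y) (T z)].
  exact: (cvg_app_entourageP _ _ _).1 (cT y Gy) _ W.
have [B [e' [l' [e'0 /andP[l'0 _] sB]]] BT] := (nbhsP _ _).1 nT.
exists e', l'; split=> // z Gz yz.
by apply: (BT z) => //; apply/xsectionP; exact: sB.
Qed.

Section gluing.
Hypotheses (G_convex : L0_convex G) (T_stable : sigma_stable_on G T).

(** With [a] the indicator of [B], the glued vector is [a *: x + (1 - a) *: y], so convexity puts it
    in [G]. It is also a concatenation, so [T] can be computed piecewise. *)
Lemma glue2 (B : set Omega) x y : measurable B -> G x -> G y ->
  exists2 z, G z & {ae P, forall w,
    (B w -> z w = x w /\ T z w = T x w) /\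
    (~ B w -> z w = y w /\ T z w = T y w)}.
Proof.
move=> mB Gx Gy.
(* The partition is [B], its complement, then empty pieces, on which the value of [s] is
   irrelevant. *)
have mA n : measurable (bigcup2 B (~` B) n).
  by case: n => [|[|n]] //=; exact: measurableC.
have tA : trivIset setT (bigcup2 B (~` B)) by rewrite -trivIset_bigcup2 setICr.
have cA : \bigcup_n bigcup2 B (~` B) n = setT by rewrite bigcup2E setUv.
pose A := CountablePartition mA tA cA.
pose s (n : nat) := if n == 0%N then x else y.
have Gs n : G (s n) by rewrite /s; case: ifP.
exists (L0v_concat A s).
  pose a := L0_indic P mB.
  have aE : {ae P, forall w, a w = \1_B w} by exact: L0_classE.
  have -> : L0v_concat A s = a *: x + (1 - a) *: y.
    apply/L0v_eqP.
    ae_app aE; ae_app (L0v_concatE A s).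
    ae_app (L0v_DE (a *: x) ((1 - a) *: y)).
    ae_app (L0v_ZE a x); ae_app (L0v_ZE (1 - a) y).
    ae_app (L0_DE 1 (- a)); ae_app (L0_NE a); ae_app (L0_1E P).
    apply: aeW => w e1 e2 e3 e4 e5 e6 e7 e8 i.
    rewrite e6 e5 e4 e3 e2 e1 e8 indicE.
    have [/set_mem Bw|/negP nB] := boolP (w \in B).
      by rewrite (e7 0%N)// subrr mul0r mul1r addr0.
    rewrite (e7 1%N) /=; last by move=> /mem_set.
    by rewrite subr0 mul0r mul1r add0r.
  apply: G_convex => //.
    by ae_app aE; ae_app (L0_0E P); apply: aeW => w -> ae; rewrite ae.
  ae_app aE; ae_app (L0_1E P); apply: aeW => w -> ae; rewrite ae indicE.
  by case: (_ \in _).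
rewrite (T_stable A s Gs).
ae_app (L0v_concatE A s); ae_app (L0v_concatE A (T \o s)).
by apply: aeW => w e1 e2; split=> Bw;
  [rewrite (e1 0%N) ?(e2 0%N)|rewrite (e1 1%N) ?(e2 1%N)].
Qed.

(** Induction on [k]: the previous maximiser [v] is kept where it still dominates [u k.+1], and
    replaced by [u k.+1] elsewhere. *)
Lemma glue_argmax u y (k : nat) : (forall n, G (u n)) ->
  exists2 z, G z & {ae P, forall w,
    (exists j, z w = u j w) /\
    (forall i, (i <= k)%N ->
      L0_norm (T (u i) - y) w <= L0_norm (T z - y) w)}.
Proof.
move=> Gu; elim: k => [|k [v Gv vP]].
  exists (u 0%N) => //; apply: aeW => w; split; first by exists 0%N.
  by move=> i; rewrite leqn0 => /eqP ->.
pose B := [set w | L0_norm (T (u k.+1) - y) w <= L0_norm (T v - y) w].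
have mB : measurable B.
  have := measurable_fun_le measurableT (L0_meas (L0_norm (T (u k.+1) - y)))
    (L0_meas (L0_norm (T v - y))).
  by rewrite setTI.
have [z Gz zP] := glue2 B v (u k.+1) mB Gv (Gu _).
exists z => //.
ae_app vP; ae_app zP; ae_app (L0_norm_sub_local (T z) (T v) y).
ae_app (L0_norm_sub_local (T z) (T (u k.+1)) y).
apply: aeW => w ezu ezv [zB znB] [[j vj] vmax].
have [Bw|nBw] := pselect (B w).
  have [zv Tzv] := zB Bw; split; first by exists j; rewrite zv.
  move=> i; rewrite leq_eqVlt ezv// => /predU1P[->//|]; exact: vmax.
have [zu Tzu] := znB nBw; split; first by exists k.+1.
move=> i; rewrite leq_eqVlt ezu// => /predU1P[->//|ik].
apply: le_trans (vmax i ik) _; apply: ltW; rewrite ltNge; exact/negP.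
Qed.

End gluing.
End stable_maps.

Theorem proposition5p8 (dsp : measure_display) (Omega : measurableType dsp)
    (R : realType) (P : probability Omega R) (d : nat) (d_gt0 : (0 < d)%N)
    (G : set (L0v P d)) (T : L0v P d -> L0v P d)
    (G_closed : closed G) (G_convex : L0_convex G)
    (T_stable : sigma_stable_on G T)
    (T_continuous : {within G, continuous T}) :
  as_seq_continuous_on G T.
Proof.
move=> u y Gu Gy uy; apply: tail_close_as_cvg => e l e0 l01.
have [e' [l' [e'0 l'0 Tclose]]] :=
  within_continuous_prob_close G T T_continuous Gy e0 l01.
(* This [m] is fixed before [k]: the tail set bounds all later terms at once, so it serves every
   glued [z] below. *)
have [m mP] := as_cvg_tail_close uy e'0 l'0.
exists m.
(* The range is [j <= k], as in [glue_argmax]. *)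
pose F k := \bigcap_(j in `I_k.+1) [set w | L0_norm (T (u (m + j)%N) - T y) w < e].
have mF k : measurable (F k).
  by apply: bigcap_measurable => [|j _]; [exists 0%N|exact: L0_norm_lt_meas].
have FE : tail_close (T \o u) (T y) e m = \bigcap_k F k.
  apply/seteqP; split=> [w mw k _ j _|w Fw j _]; first exact: mw.
  by apply: (Fw j) => /=.
have PF k : ((1 - l)%:E <= P (F k))%E.
  have [z Gz zP] := glue_argmax G T G_convex T_stable
    (fun j => u (m + j)%N) (T y) k (fun j => Gu _).
  have /Tclose : prob_close e' l' y z.
    apply: prob_close_sym; apply: lt_le_trans mP _; apply: le_prob_ae.
    - exact: measurable_tail_close.
    - exact: L0_norm_lt_meas.
    have local : {ae P, forall w j, z w = u (m + j)%N w ->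
        L0_norm (z - y) w = L0_norm (u (m + j)%N - y) w}.
      by apply: ae_foralln => j; exact: L0_norm_sub_local.
    by apply: filterS2 local zP => w loc [[j /loc zj] _] mw /=; rewrite zj; exact: mw.
  move=> /(_ Gz) /prob_close_sym /ltW /le_trans; apply.
  apply: le_prob_ae => //; first exact: L0_norm_lt_meas.
  by apply: filterS zP => w [_ zmax] ze j /= jk; exact: le_lt_trans (zmax j jk) ze.
(* Continuity from above carries the bound, uniform in [k], to the whole tail. *)
have cv : (P \o F) k @[k --> \oo] --> P (\bigcap_k F k).
  apply: nonincreasing_cvg_mu => //.
  - by rewrite ltey_eq fin_num_measure.
  - exact: bigcapT_measurable.
  - move=> a b ab; apply/subsetPset => w bw j /= ja; apply: bw => /=.
    exact: leq_trans ja _.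
have -> : P (tail_close (fun n => T (u n)) (T y) e m) = P (\bigcap_k F k).
  by rewrite -FE.
rewrite -(cvg_lim _ cv)//; apply: lime_ge; first by apply/cvg_ex; eexists; exact: cv.
exact: nearW.
Qed.
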